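(* Let $K$ be a field of characteristic zero and let $n \ge 3$. Let $\mathcal{W} \subset \mathcal{M}_n(K)$ be the subalgebra of all matrices whose $n$-th row, $(n-1)$-th row and $n$-th column are all zero, and let $\mathcal{W}^{\mathrm{T}} = \{W^{\mathrm{T}} : W\in\mathcal{W}\}$, i.e. the subalgebra of all matrices whose $n$-th row, $(n-1)$-th column and $n$-th column are all zero. Let $\Gamma$ be the set of all nonunital intersections in $\mathcal{M}_n(K)$. Then, up to similarity, $\mathcal{W}$ and $\mathcal{W}^{\mathrm{T}}$ are the only subalgebras of $\mathcal{M}_n(K)$ in $\Gamma$ having dimension $(n-1)(n-2)$ over $K$. That is, a subalgebra $\mathcal{N}\subset\mathcal{M}_n(K)$ satisfies $\mathcal{N}\in\Gamma$ and $\dim_K\mathcal{N}=(n-1)(n-2)$ if and only if $\mathcal{N}$ is similar to $\mathcal{W}$ or to $\mathcal{W}^{\mathrm{T}}$.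
   Context: $\mathcal{M}_n(K)$ is the algebra of $n\times n$ matrices over $K$. A subalgebra of $\mathcal{M}_n(K)$ is a $K$-linear subspace closed under matrix multiplication; it need not contain the identity matrix $I$. A subalgebra is called unital if it has a (two-sided) multiplicative identity (unity) of its own, which need not equal $I$; it is called nonunital if it has no such unity. A nonunital intersection in $\mathcal{M}_n(K)$ is a nonunital subalgebra $\mathcal{N}\subset \mathcal{M}_n(K)$ such that $\mathcal{N} = \mathcal{U}\cap\mathcal{V}$ for some two unital subalgebras $\mathcal{U},\mathcal{V}\subset\mathcal{M}_n(K)$ (whose unities need not be $I$ and need not coincide). Subalgebras $\mathcal{A},\mathcal{B}\subset\mathcal{M}_n(K)$ are similar if $\mathcal{A} = \{S^{-1}BS : B\in\mathcal{B}\}$ for some invertible $S\in\mathcal{M}_n(K)$. *)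

(* Defs.v *)
From HB Require Import structures.
From mathcomp Require Import all_boot all_order all_algebra.

Set Implicit Arguments.
Unset Strict Implicit.
Unset Printing Implicit Defensive.

Import GRing.Theory.

Local Open Scope ring_scope.

Section Subalgebras.

Variables (K : fieldType) (n : nat).

(* Linear subspaces closed under the matrix product; 1%:M need not belong. *)
Definition is_subalgebra (A : {vspace 'M[K]_n}) : Prop :=
  {in A &, forall X Y, X *m Y \in A}.

(* The unity of A is any two-sided identity in A, possibly different from    *)
(* 1%:M. In contrast with has_algid, it may be 0: the zero algebra is unital. *)
Definition has_unity (A : {vspace 'M[K]_n}) : Prop :=
  exists2 E, E \in A & {in A, forall X, E *m X = X /\ X *m E = X}.

Definition unital_subalgebra (A : {vspace 'M[K]_n}) : Prop :=
  is_subalgebra A /\ has_unity A.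

Definition nonunital_subalgebra (A : {vspace 'M[K]_n}) : Prop :=
  is_subalgebra A /\ ~ has_unity A.

Definition nonunital_intersection (N : {vspace 'M[K]_n}) : Prop :=
  nonunital_subalgebra N /\
  exists U V : {vspace 'M[K]_n},
    [/\ unital_subalgebra U, unital_subalgebra V & N = (U :&: V)%VS].

Definition similar_subalgebras (A B : {vspace 'M[K]_n}) : Prop :=
  exists2 S : 'M[K]_n, S \in unitmx &
    forall X, X \in A <-> exists2 Y, Y \in B & X = invmx S *m Y *m S.

Definition restr_mx (P : rel 'I_n) (M : 'M[K]_n) : 'M[K]_n :=
  \matrix_(i, j) if P i j then M i j else 0.

Fact restr_mx_is_linear (P : rel 'I_n) : linear (restr_mx P).
Proof.
move=> a A B; apply/matrixP=> i j; rewrite !mxE.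
by case: (P i j); rewrite // mulr0 addr0.
Qed.

HB.instance Definition _ (P : rel 'I_n) :=
  GRing.isLinear.Build K 'M[K]_n 'M[K]_n _ (restr_mx P)
    (restr_mx_is_linear P).

Definition vanishing_space (P : rel 'I_n) : {vspace 'M[K]_n} :=
  lker (linfun (restr_mx P)).

Lemma vanishing_spaceP (P : rel 'I_n) (M : 'M[K]_n) :
  reflect (forall i j, P i j -> M i j = 0) (M \in vanishing_space P).
Proof.
rewrite memv_ker lfunE /=; apply: (iffP eqP) => [M0 i j Pij | M0].
  by move/matrixP/(_ i j): M0; rewrite !mxE Pij.
apply/matrixP=> i j; rewrite !mxE.
by case: ifP => // /M0.
Qed.

(* Indices start at 0: the last row and column have index n.-1, and the      *)
(* last row but one has index n.-2.                                          *)
Definition Wspace : {vspace 'M[K]_n} :=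
  vanishing_space (fun i j : 'I_n =>
    [|| val i == n.-1, val i == n.-2 | val j == n.-1]).

Definition Wspace_tr : {vspace 'M[K]_n} := (linfun trmx @: Wspace)%VS.

Lemma mem_Wspace_tr (M : 'M[K]_n) : (M \in Wspace_tr) = (M^T \in Wspace).
Proof.
apply/memv_imgP/idP => [[A WA ->] | WM]; first by rewrite lfunE /= trmxK.
by exists M^T; rewrite // lfunE /= trmxK.
Qed.

Lemma Wspace_subalgebra : is_subalgebra Wspace.
Proof.
move=> A B /vanishing_spaceP WA /vanishing_spaceP WB.
apply/vanishing_spaceP => i j Pij; rewrite mxE big1 // => k _.
case/or3P: Pij => [Pi|Pi|Pj].
- by rewrite WA ?mul0r // Pi.
- by rewrite WA ?mul0r // Pi orbT.
by rewrite WB ?mulr0 // Pj !orbT.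
Qed.

Lemma Wspace_tr_subalgebra : is_subalgebra Wspace_tr.
Proof.
move=> A B; rewrite !mem_Wspace_tr trmx_mul => WA WB.
exact: Wspace_subalgebra.
Qed.

End Subalgebras.

Arguments Wspace : clear implicits.
Arguments Wspace_tr : clear implicits.

(* Main.v *)
Require Import Defs.
From mathcomp Require Import all_boot all_order all_algebra.
From mathcomp Require Import perm zify.

Set Implicit Arguments.
Unset Strict Implicit.
Unset Printing Implicit Defensive.

Import GRing.Theory.

Local Open Scope ring_scope.

(**
Let N be the intersection of two algebras with unities E and F. If N has no
unity, E and F cannot both be the identity matrix, so one of them, G say, is
an idempotent other than 1 that acts as a unity on N. A column b and a row w
of 1 - G, scaled so that w b = 1, then satisfy N b = 0 and w N = 0.
Conversely such a pair makes a nonunital N the intersection of K 1 + N and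
K (1 - b w) + N (nonunital_intersectionP). Thus N lives in the corner cut out
by the rank n - 1 idempotent 1 - b w, which is a copy A of N inside the
matrices of order r = n - 1 (corner_split), of dimension r (r - 1) and not
containing the identity.

The heart of the proof is that such an A kills a nonzero row or a nonzero
column (large_subalgebra_annihilated). Put A1 = K 1 + A. Its codimension is
smaller than r, so A1 meets the r-dimensional space of matrices c u, for a
fixed row u, in some nonzero c u. If every row is in u A1 and every column in
A1 c, then A1 contains all rank one matrices, in particular the matrix units.
Those of square zero must lie in A, and A is an ideal of A1, so all matrix
units lie in A and so does 1, which is absurd. Otherwise A stabilises a
proper nonzero subspace, of dimension k say. The stabiliser of a subspace has
codimension k (r - k), which leaves only k = 1 and k = r - 1, cases that the
transpose exchanges. For k = 1 the dimensions force A1 to be the whole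
stabiliser of a line, where the matrix units of an adapted basis can be
handled explicitly (line_annihilated).

Back in order n, the row (say) h killed by A, together with w and b, says that
N lies in the space of the X with h X = 0, w X = 0 and X b = 0. The triples
(h, w, b) with h b = 0 and w b = 1 form one orbit under change of basis
(frame_transitive), so this space is a conjugate of W, and the dimensions
agree. A killed column gives the transpose of W in the same way.
*)

(** * Nonunital intersections *)

Section NonunitalIntersection.
Variables (K : fieldType) (n : nat).
Implicit Types (A N : {vspace 'M[K]_n}).

Lemma mem_adjoin E A X :
  reflect (exists a, exists2 Y, Y \in A & X = a *: E + Y) (X \in <[E]> + A)%VS.
Proof.
apply: (iffP memv_addP) => [[_ /vlineP[a ->] [Y YA ->]]|[a [Y YA ->]]].
  by exists a, Y.
by exists (a *: E); [rewrite memvZ ?memv_line | exists Y].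
Qed.

Lemma adjoin_unital E A : is_subalgebra A -> E *m E = E ->
  {in A, forall X, E *m X = X /\ X *m E = X} ->
  unital_subalgebra (<[E]> + A)%VS.
Proof.
move=> sA EE EA; split.
  move=> _ _ /mem_adjoin[a [X XA ->]] /mem_adjoin[c [Y YA ->]].
  apply/mem_adjoin; exists (a * c), (a *: Y + c *: X + X *m Y).
    by rewrite !memvD ?memvZ // sA.
  rewrite mulmxDl !mulmxDr -!scalemxAl -!scalemxAr EE.
  by rewrite (EA _ YA).1 (EA _ XA).2 scalerA !addrA.
exists E; first by apply/mem_adjoin; exists 1, 0; rewrite ?mem0v // scale1r addr0.
move=> _ /mem_adjoin[a [X XA ->]].
by rewrite mulmxDl mulmxDr -!scalemxAl -!scalemxAr EE (EA _ XA).1 (EA _ XA).2.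
Qed.

(** This replaces the two algebras U and V by vectors. Either of U and V may have
the unity 1, but not both. In the converse direction multiplying by b on the
right tells K 1 + N apart from K (1 - b w) + N. *)
Lemma nonunital_intersectionP N :
  nonunital_intersection N <->
  nonunital_subalgebra N /\
  exists (b : 'cV_n) (w : 'rV_n),
    [/\ w *m b = 1%:M, {in N, forall X, X *m b = 0}
      & {in N, forall X, w *m X = 0}].
Proof.
split=> [[nuN [U [V [[_ [E EU uE]] [_ [F FV uF]] defN]]]] | [nuN [b [w [wb Nb wN]]]]].
  split=> //.
  have [G [GG nG1 NG]] : exists G : 'M[K]_n, [/\ G *m G = G, G != 1%:M
      & {in N, forall X, G *m X = X /\ X *m G = X}].
    have [E1|nE1] := eqVneq E 1%:M; last first.
      exists E; split=> //; first by case: (uE E EU).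
      by move=> X; rewrite defN memv_cap => /andP[/uE].
    have [F1|nF1] := eqVneq F 1%:M; last first.
      exists F; split=> //; first by case: (uF F FV).
      by move=> X; rewrite defN memv_cap => /andP[_ /uF].
    case: nuN.2; exists 1%:M; first by rewrite defN memv_cap -{1}E1 EU -F1 FV.
    by move=> X _; rewrite mul1mx mulmx1.
  (* H is a nonzero idempotent: a nonzero entry (i, j) of H = H H is the product
     of row i and column j. *)
  pose H := 1%:M - G.
  have [i [j Hij]] : exists i j, H i j != 0.
    have /matrix0Pn[i [j Hij]] : H != 0 by rewrite subr_eq0 eq_sym.
    by exists i, j.
  have HH : H *m H = H by rewrite mulmxBr mulmx1 mulmxBl GG mul1mx subrr subr0.
  exists (col j H), ((H i j)^-1 *: row i H); split=> [|X XN|X XN].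
  - apply/matrixP=> x y; rewrite !ord1 colE mulmxA -scalemxAl -row_mul HH.
    rewrite -scalemxAl -colE.
    by move: Hij; rewrite !mxE eqxx => /mulVf.
  - rewrite colE mulmxA mulmxBr mulmx1 (NG X XN).2 subrr mul0mx //.
  - by rewrite -scalemxAl -row_mul mulmxBl mul1mx (NG X XN).1 subrr row0 scaler0.
split=> //; exists (<[1%:M]> + N)%VS, (<[1%:M - b *m w]> + N)%VS.
have sN := nuN.1.
split.
- apply: adjoin_unital; rewrite ?mulmx1 // => X _; by rewrite mul1mx mulmx1.
- apply: adjoin_unital => // [|X XN].
    by rewrite mulmxBr mulmx1 mulmxBl mul1mx mulmxA -(mulmxA b) wb mulmx1 subrr subr0.
  by rewrite mulmxBr mulmxBl mulmx1 mul1mx mulmxA Nb // -mulmxA wN // mul0mx mulmx0 subr0.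
apply/vspaceP=> X; rewrite memv_cap; apply/idP/andP => [XN|[/mem_adjoin[a [Y YN ->]]]].
  by split; apply: (subvP (addvSr _ _)).
case/mem_adjoin=> [c [Z ZN]] /(congr1 (fun M => w *m (M *m b))).
rewrite !mulmxDl -!scalemxAl !mul1mx (Nb Y YN) (Nb Z ZN) !addr0.
rewrite mulmxBl mul1mx -mulmxA wb mulmx1 subrr scaler0 mulmx0 -scalemxAr wb.
move/matrixP/(_ 0 0); rewrite !mxE eqxx mulr1 => ->.
by rewrite scale0r add0r.
Qed.
End NonunitalIntersection.

(** * Stabilisers of subspaces *)

Section Sandwich.
Variables (K : fieldType) (p m n q : nat) (L : 'M[K]_(p, m)) (R : 'M[K]_(n, q)).

Definition sandwich : 'Hom('M[K]_(m, n), 'M[K]_(p, q)) :=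
  linfun (mulmxr R \o mulmx L).

Lemma sandwichE X : sandwich X = L *m X *m R.
Proof. by rewrite lfunE. Qed.

Lemma dim_lker_sandwich : row_free L -> row_full R ->
  (\dim (lker sandwich) + p * q = m * n)%N.
Proof.
move=> /row_freeP[L' LL'] /row_fullP[R' R'R].
have img : limg sandwich = fullv.
  apply/vspaceP=> Y; rewrite memvf; apply/memv_imgP.
  exists (L' *m Y *m R'); rewrite ?memvf // sandwichE.
  by rewrite !mulmxA LL' mul1mx -mulmxA R'R mulmx1.
by have := limg_ker_dim sandwich fullv; rewrite capfv img !dimvf.
Qed.
End Sandwich.

Section Stabiliser.
Variables (K : fieldType) (p n : nat) (U : 'M[K]_(p, n)).

Definition stabiliser : {vspace 'M[K]_n} :=
  lker (sandwich (row_base U) (col_base (cokermx U))).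

Lemma mem_stabiliser X : (X \in stabiliser) = stablemx U X.
Proof.
have coker0 (M : 'M_(\rank U, n)) :
    (M *m col_base (cokermx U) == 0) = (M *m cokermx U == 0).
  rewrite -[in RHS](mulmx_base (cokermx U)) mulmxA.
  by rewrite -(inj_eq (row_free_inj (row_base_free (cokermx U)))) mul0mx.
by rewrite memv_ker sandwichE coker0 -submxE -(eq_row_base U) stablemx_row_base.
Qed.

(** In a basis adapted to U, stabilising U means that one block with \rank U
rows and n - \rank U columns vanishes. *)
Lemma dim_stabiliser :
  (\dim stabiliser + \rank U * (n - \rank U) = n * n)%N.
Proof.
by rewrite -{1}(mxrank_coker U) dim_lker_sandwich ?row_base_free ?col_base_full.
Qed.
End Stabiliser.

(** * Adjoining the identity matrix *)

Section AdjoinOne.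
Variables (K : fieldType) (n : nat) (A : {vspace 'M[K]_n}).
Hypothesis sA : is_subalgebra A.
Local Notation A1 := (<[1%:M]> + A)%VS.

Lemma adjoin1_mull X Y : X \in A1 -> Y \in A -> X *m Y \in A.
Proof.
case/mem_adjoin=> a [Z ZA ->] YA.
by rewrite mulmxDl -scalemxAl mul1mx memvD ?memvZ ?sA.
Qed.

Lemma adjoin1_mulr X Y : X \in A1 -> Y \in A -> Y *m X \in A.
Proof.
case/mem_adjoin=> a [Z ZA ->] YA.
by rewrite mulmxDr -scalemxAr mulmx1 memvD ?memvZ ?sA.
Qed.

Lemma adjoin1_mul : is_subalgebra A1.
Proof.
apply: (adjoin_unital sA _ _).1; rewrite ?mulmx1 // => X _.
by rewrite mul1mx mulmx1.
Qed.

Hypothesis n1A : 1%:M \notin A.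

Lemma dim_adjoin1 : \dim A1 = (\dim A).+1.
Proof.
rewrite dimv_disjoint_sum ?dim_vline.
  by case: eqP n1A => [->|//]; rewrite mem0v.
apply/eqP; rewrite -subv0; apply/subvP=> _ /memv_capP[/vlineP[a ->]].
have [->|a0] := eqVneq a 0; first by move=> _; rewrite scale0r mem0v.
by move=> /(memvZ a^-1); rewrite scalerA mulVf // scale1r (negPf n1A).
Qed.

(** The quotient of K 1 + A by its ideal A is the field K, which has no
nonzero nilpotent element. This is what puts off-diagonal matrix units into A. *)
Lemma adjoin1_sqr0 X : X \in A1 -> X *m X = 0 -> X \in A.
Proof.
case/mem_adjoin=> a [Y YA ->] sq0.
have [->|a0] := eqVneq a 0; first by rewrite scale0r add0r.
case/negP: n1A.
have -> : 1%:M = - (a ^+ 2)^-1 *: ((a *+ 2) *: Y + Y *m Y).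
  have e : (a ^+ 2) *: 1%:M + ((a *+ 2) *: Y + Y *m Y) = 0.
    rewrite -sq0 mulmxDl !mulmxDr -!scalemxAl -!scalemxAr !mul1mx mulmx1.
    by rewrite scalerA mulr2n scalerDl !addrA.
  rewrite -[X in _ *: X](addKr (a ^+ 2 *: 1%:M)) e addr0 scalerN scaleNr opprK.
  by rewrite scalerA mulVf ?scale1r // expf_neq0.
by rewrite memvZ // memvD ?memvZ ?sA.
Qed.

(** The rows u X, for X in A1, as the row space of a matrix, so that its rank and
its stability can be discussed. *)
Lemma orbit_row (u : 'rV[K]_n) :
  exists d (M : 'M_(d, n)), forall v : 'rV_n,
    (v <= M)%MS <-> exists2 X, X \in A1 & v = u *m X.
Proof.
exists (\dim A1), (\matrix_i (u *m (vbasis A1)`_i)) => v.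
have eD (D : 'rV_(\dim A1)) : D *m (\matrix_i (u *m (vbasis A1)`_i)) =
    u *m (\sum_i D 0 i *: (vbasis A1)`_i).
  rewrite mulmx_sum_row mulmx_sumr; apply: eq_bigr => i _.
  by rewrite rowK -scalemxAr.
split=> [/submxP[D ->]|[X XA ->]].
  rewrite eD; exists (\sum_i D 0 i *: (vbasis A1)`_i) => //.
  by apply: memv_suml => i _; rewrite memvZ // vbasis_mem ?memt_nth.
apply/submxP; exists (\row_i coord (vbasis A1) i X); rewrite eD; congr (_ *m _).
rewrite {1}(coord_vbasis XA); apply: eq_bigr => i _; by rewrite mxE.
Qed.
End AdjoinOne.

(** * Transposition *)

Section Transpose.
Variables (K : fieldType) (n : nat).
Implicit Type A : {vspace 'M[K]_n}.

Definition trspace A : {vspace 'M[K]_n} := (linfun trmx @: A)%VS.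

Lemma mem_trspace A X : (X \in trspace A) = (X^T \in A).
Proof.
apply/memv_imgP/idP => [[Y YA ->]|XA]; first by rewrite lfunE /= trmxK.
by exists X^T; rewrite // lfunE /= trmxK.
Qed.

Lemma trspaceK : involutive trspace.
Proof. by move=> A; apply/vspaceP=> X; rewrite !mem_trspace trmxK. Qed.

Lemma dim_trspace A : \dim (trspace A) = \dim A.
Proof.
apply/limg_dim_eq/eqP; rewrite -subv0; apply/subvP=> X /memv_capP[_].
by rewrite memv_ker lfunE /= memv0 trmx_eq0.
Qed.

Lemma trspace_subalgebra A : is_subalgebra A -> is_subalgebra (trspace A).
Proof. by move=> sA X Y; rewrite !mem_trspace trmx_mul => XA YA; apply: sA. Qed.

Lemma trspace_unity A : has_unity A -> has_unity (trspace A).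
Proof.
case=> E EA uE; exists E^T; rewrite ?mem_trspace ?trmxK // => X.
rewrite mem_trspace => /uE[EX XE].
by split; apply: trmx_inj; rewrite trmx_mul trmxK.
Qed.

Lemma trspace_nonunital_intersection A :
  nonunital_intersection A -> nonunital_intersection (trspace A).
Proof.
case/nonunital_intersectionP=> -[sA nuA] [b [w [wb Ab wA]]].
apply/nonunital_intersectionP; split.
  split; first exact: trspace_subalgebra.
  by move/trspace_unity; rewrite trspaceK.
exists w^T, b^T; split=> [|X|X]; rewrite ?mem_trspace; last 2 first.
- by move/wA=> h; apply: trmx_inj; rewrite trmx_mul trmxK h trmx0.
- by move/Ab=> h; apply: trmx_inj; rewrite trmx_mul trmxK h trmx0.
by rewrite -trmx_mul wb trmx1.
Qed.

Definition annihilated A :=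
  (exists2 u : 'rV_n, u != 0 & {in A, forall X, u *m X = 0}) \/
  (exists2 c : 'cV_n, c != 0 & {in A, forall X, X *m c = 0}).

Lemma annihilated_tr A : annihilated (trspace A) -> annihilated A.
Proof.
case=> [[u u0 uA]|[c c0 Ac]]; [right; exists u^T | left; exists c^T];
  rewrite ?trmx_eq0 // => X XA; apply: trmx_inj; rewrite trmx_mul trmxK trmx0.
  by apply: uA; rewrite mem_trspace trmxK.
by apply: Ac; rewrite mem_trspace trmxK.
Qed.
End Transpose.

(** * Matrix units in an arbitrary basis *)

Lemma row_delta_unit (K : fieldType) n (i : 'I_n) (u : 'rV[K]_n) :
  u != 0 -> exists2 T, T \in unitmx & delta_mx 0 i *m T = u.
Proof.
case: n i u => [|n] i u u0; first by case: i.
pose a := col_ebase u 0 0.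
have a0 : a \is a GRing.unit.
  by have := col_ebase_unit u; rewrite unitmxE [col_ebase u]mx11_scalar det_scalar1.
exists (a *: (tperm_mx 0 i *m row_ebase u)).
  by rewrite unitmxZ // unitmx_mul unitmx_perm row_ebase_unit.
rewrite -[RHS]mulmx_ebase rank_rV u0 [col_ebase u]mx11_scalar.
rewrite -scalemxAr mulmxA mul_scalar_mx -scalemxAl; congr (_ *: (_ *m _)).
apply/matrixP=> x y; by rewrite !ord1 -rowE !mxE tpermR -val_eqE andbT.
Qed.

Section MatrixUnits.
Variables (K : fieldType) (n : nat) (T : 'M[K]_n).
Hypothesis uT : T \in unitmx.

(** The matrix units relative to the basis formed by the rows of T. *)
Definition unit_at i j : 'M[K]_n := invmx T *m delta_mx i j *m T.

Lemma unit_atM i j k l :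
  unit_at i j *m unit_at k l = if j == k then unit_at i l else 0.
Proof.
rewrite /unit_at !mulmxA mulmxK // -[_ *m delta_mx k l]mulmxA mul_delta_mx_cond.
by case: (j == k); rewrite ?mulmx0 ?mul0mx.
Qed.

Lemma sum_unit_at : \sum_i unit_at i i = 1%:M.
Proof.
rewrite -mulmx_suml -mulmx_sumr.
rewrite (_ : \sum_i _ = 1%:M) ?mulmx1 ?mulVmx //.
by rewrite [RHS]scalar_mx_sum_delta; apply: eq_bigr => i _; rewrite scale1r.
Qed.

Lemma unit_at_corner i j X :
  exists c, unit_at i i *m X *m unit_at j j = c *: unit_at i j.
Proof.
exists ((T *m X *m invmx T) i j).
rewrite /unit_at -[delta_mx i i](mul_delta_mx (0 : 'I_1)).
rewrite -[delta_mx j j](mul_delta_mx (0 : 'I_1)) -[delta_mx i j](mul_delta_mx (0 : 'I_1)).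
set Z := T *m X *m invmx T.
have -> : Z i j *: (invmx T *m (delta_mx i (0 : 'I_1) *m delta_mx 0 j) *m T) =
   invmx T *m (delta_mx i (0 : 'I_1) *m (Z i j)%:M *m delta_mx 0 j) *m T.
  by rewrite mul_mx_scalar -scalemxAl -scalemxAr -scalemxAl.
have -> : (Z i j)%:M = delta_mx 0 i *m Z *m delta_mx j 0 :> 'M_1.
  by apply/matrixP=> x y; rewrite !ord1 -rowE -colE !mxE eqxx.
by rewrite /Z !mulmxA.
Qed.
End MatrixUnits.

(** * Large subalgebras without the identity matrix *)

Lemma mem_adjoin1_tr (K : fieldType) n (A : {vspace 'M[K]_n}) X :
  (X \in <[1%:M]> + trspace A)%VS = (X^T \in <[1%:M]> + A)%VS.
Proof.
apply/mem_adjoin/mem_adjoin => -[a [Y YA eX]].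
  exists a, Y^T; first by rewrite -mem_trspace.
  by rewrite eX linearD linearZ /= trmx1.
exists a, Y^T; first by rewrite mem_trspace trmxK.
by apply: trmx_inj; rewrite eX linearD linearZ /= trmx1 trmxK.
Qed.

Section Core.
Variables (K : fieldType) (m : nat).
Local Notation r := m.+2.
Implicit Types A : {vspace 'M[K]_r}.

(** A is an ideal of K 1 + A, so a diagonal matrix unit in A pulls in every other
one that off-diagonal units of K 1 + A link to it. They cannot all be in A if 1
is not, since 1 is their sum. *)
Lemma unit_at_diag A T i0 i : T \in unitmx -> is_subalgebra A ->
  unit_at T i0 i0 \in A -> unit_at T i i0 \in (<[1%:M]> + A)%VS ->
  unit_at T i0 i \in (<[1%:M]> + A)%VS -> unit_at T i i \in A.
Proof.
move=> uT sA d0 li ri.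
have := adjoin1_mulr sA ri (adjoin1_mull sA li d0).
by rewrite unit_atM // eqxx unit_atM // eqxx.
Qed.

(** By dimension, A1 = K 1 + A is the full stabiliser of the line K u. Take a basis with
u in position 0. If A does not kill u, an element of A acts on u by a nonzero
scalar, which puts the matrix unit (0, 0) in A; since 1 is not in A, the last
diagonal unit is not in A. For r > 2 this is absurd, because the
last diagonal unit factors through an off-diagonal one, of square zero, hence
in A. For r = 2 it forces the lower right entry of all elements of A to
vanish, and A kills a column. *)
Lemma line_annihilated A (u : 'rV_r) :
  is_subalgebra A -> 1%:M \notin A -> (r * m.+1 <= \dim A)%N ->
  u != 0 -> {in A, forall X, stablemx u X} -> annihilated A.
Proof.
move=> sA n1A dA u0 uA.
have eA1 : (<[1%:M]> + A)%VS = stabiliser u.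
  apply/eqP; rewrite eqEdim; apply/andP; split.
    apply/subvP=> _ /mem_adjoin[a [X XA ->]]; rewrite mem_stabiliser.
    by rewrite mulmxDr -scalemxAr mulmx1 addmx_sub ?scalemx_sub ?uA.
  rewrite dim_adjoin1 //; have := dim_stabiliser u.
  rewrite rank_rV u0 mul1n subn1 /=.
  by move: dA; set d := \dim A; set s := \dim _; move: d s => d s; nia.
have [T uT eT] := row_delta_unit 0 u0.
have uE i j : u *m unit_at T i j = if i == 0 then delta_mx 0 j *m T else 0.
  rewrite -eT !mulmxA mulmxK // mul_delta_mx_cond eq_sym.
  by case: eqP; rewrite ?mul0mx.
have memE i j : (i != 0) || (j == 0) -> unit_at T i j \in (<[1%:M]> + A)%VS.
  rewrite eA1 mem_stabiliser uE; have [_ /= /eqP->|_ _] := eqVneq i 0.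
    by rewrite eT.
  by rewrite sub0mx.
have mull := adjoin1_mull sA; have mulr := adjoin1_mulr sA.
have [/subvP ann|/subvPn[X XA]] := boolP (A <= lker (sandwich u 1%:M))%VS.
  left; exists u => // X /ann; rewrite memv_ker sandwichE mulmx1 => /eqP //.
rewrite memv_ker sandwichE mulmx1; case/sub_rVP: (uA X XA) => a uX.
rewrite uX scaler_eq0 (negPf u0) orbF => a0.
have E0 : unit_at T 0 0 \in A.
  have e : unit_at T 0 0 *m X = a *: unit_at T 0 0.
    rewrite /unit_at -[delta_mx 0 0](mul_delta_mx (0 : 'I_1)) -!mulmxA.
    by rewrite [delta_mx 0 0 *m (T *m X)]mulmxA eT uX -!scalemxAr.
  by rewrite -[unit_at T 0 0](scalerK a0) -e memvZ // mull ?memE.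
have nE1 : unit_at T ord_max ord_max \notin A.
  apply: contra n1A => E1; rewrite -(sum_unit_at uT) memv_suml // => i _.
  have [->//|i0] := eqVneq i 0.
  by apply: (unit_at_diag uT sA E1); rewrite memE ?i0 ?orbT.
(* Here r = m + 2: for m > 0 there is an index k other than 0 and ord_max. *)
case: (posnP m) => [m0|m_gt0]; last first.
  pose k : 'I_r := inord 1.
  have k1 : val k = 1%N by rewrite /= inordK.
  have kmax : k != ord_max by rewrite -val_eqE k1 /=; lia.
  have k0 : k != 0 by rewrite -val_eqE k1.
  case/negP: nE1.
  have Ek : unit_at T ord_max k \in A.
    apply: (adjoin1_sqr0 sA n1A); first exact: memE.
    by rewrite unit_atM // (negPf kmax).
  have := mulr _ _ (memE k ord_max _) Ek; rewrite unit_atM // eqxx; apply.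
  by rewrite k0.
right; exists (invmx T *m delta_mx ord_max 0).
  rewrite -(can_eq (mulKmx uT)) mulKVmx // mulmx0; apply/matrix0Pn.
  by exists ord_max, 0; rewrite mxE !eqxx oner_eq0.
move=> Y YA.
have [c ec] := unit_at_corner T ord_max ord_max Y.
have e : Y *m unit_at T ord_max ord_max = c *: unit_at T ord_max ord_max.
  rewrite -ec -[Y in LHS]mul1mx -(sum_unit_at uT) !mulmx_suml (bigD1 ord_max) //=.
  rewrite big1 ?addr0 // => i imax.
  have -> : i = 0 by apply/val_inj; move: (ltn_ord i) imax; rewrite -val_eqE /=; lia.
  rewrite /unit_at -[delta_mx 0 0](mul_delta_mx (0 : 'I_1)) -!mulmxA.
  rewrite [delta_mx 0 0 *m (T *m _)]mulmxA eT (mulmxA u).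
  case/sub_rVP: (uA Y YA) => b ->.
  by rewrite -scalemxAl (mulmxA (invmx T)) -/(unit_at T _ _) uE /= scaler0 !mulmx0.
have c0 : c = 0.
  apply/eqP; apply: contraNT nE1 => c0.
  by rewrite -(scalerK c0 (unit_at _ _ _)) -e memvZ // mulr ?memE.
have := congr1 (fun M => M *m (invmx T *m delta_mx ord_max (0 : 'I_1))) e.
rewrite c0 scale0r mul0mx /unit_at -!mulmxA mulKVmx // mul_delta_mx.
by rewrite !mulmxA.
Qed.

Lemma rank1_annihilated A p (U : 'M_(p, r)) :
  is_subalgebra A -> 1%:M \notin A -> (r * m.+1 <= \dim A)%N ->
  \rank U = 1%N -> {in A, forall X, stablemx U X} -> annihilated A.
Proof.
move=> sA n1A dA rU UA.
have /rowV0Pn[u uU u0] : U != 0 by rewrite -mxrank_eq0 rU.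
have Uu : (U <= u)%MS.
  by have [_ <-] := mxrank_leqif_sup uU; rewrite rU rank_rV u0.
apply: (line_annihilated sA n1A dA u0) => X XA.
exact: submx_trans (submx_trans (submxMr X uU) (UA X XA)) Uu.
Qed.

Lemma one_notin_trspace A : 1%:M \notin A -> 1%:M \notin trspace A.
Proof. by rewrite mem_trspace trmx1. Qed.

(** Between the extremes 1 and r - 1 the product k (r - k) exceeds r - 1, too much
for the codimension of K 1 + A. When U is a hyperplane, its orthogonal is a line
stable under the transpose of A. *)
Lemma reducible_annihilated A p (U : 'M_(p, r)) :
  is_subalgebra A -> 1%:M \notin A -> (r * m.+1 <= \dim A)%N ->
  (0 < \rank U < r)%N -> {in A, forall X, stablemx U X} -> annihilated A.
Proof.
move=> sA n1A dA rU UA.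
have [|rU1] : \rank U = 1%N \/ \rank U = m.+1.
- have : (<[1%:M]> + A <= stabiliser U)%VS.
    apply/subvP=> _ /mem_adjoin[a [X XA ->]]; rewrite mem_stabiliser.
    by rewrite mulmxDr -scalemxAr mulmx1 addmx_sub ?scalemx_sub ?UA.
  move/dimvS; rewrite dim_adjoin1 //; have := dim_stabiliser U.
  move: dA rU; set d := \dim A; set s := \dim _; set k := \rank U.
  move: d s k => d s k dA /andP[k_gt0 k_lt] ds ltds.
  have {s d dA ds ltds} : (k * (r - k) <= m.+1)%N by nia.
  by case: k k_gt0 k_lt => // k _ k_lt; nia.
- by move=> rU1; apply: (rank1_annihilated sA n1A dA rU1).
apply: annihilated_tr.
apply: (rank1_annihilated (U := kermx U^T)) => [|||| X].
- exact: trspace_subalgebra.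
- exact: one_notin_trspace.
- by rewrite dim_trspace.
- by rewrite mxrank_ker mxrank_tr rU1 subSnn.
rewrite mem_trspace => /UA /submxP[D eD].
apply/sub_kermxP; rewrite -mulmxA -[X]trmxK -trmx_mul eD trmx_mul mulmxA.
by rewrite mulmx_ker mul0mx.
Qed.

(** The rows u X, for X in K 1 + A, form a stable subspace containing u: if it is
proper, reducible_annihilated applies. *)
Lemma cyclic_or_annihilated A (u : 'rV_r) :
  is_subalgebra A -> 1%:M \notin A -> (r * m.+1 <= \dim A)%N -> u != 0 ->
  annihilated A \/
  forall v, exists2 X, X \in (<[1%:M]> + A)%VS & v = u *m X.
Proof.
move=> sA n1A dA u0; have [d [M MP]] := orbit_row A u.
have [full|nfull] := boolP (row_full M).
  by right=> v; apply/MP; apply: submx_full.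
left; apply: (reducible_annihilated (U := M)) => // [|X XA].
  have uM : (u <= M)%MS.
    apply/MP; exists 1%:M; rewrite ?mulmx1 //.
    by apply/mem_adjoin; exists 1, 0; rewrite ?mem0v // scale1r addr0.
  apply/andP; split; last by rewrite ltn_neqAle rank_leq_col andbT.
  by apply: leq_trans (mxrankS uM); rewrite rank_rV u0.
apply/row_subP=> i; rewrite row_mul.
have /MP[Y YA ->] := row_sub i M.
apply/MP; exists (Y *m X); last by rewrite mulmxA.
by apply: (subvP (addvSr _ _)); apply: (adjoin1_mull sA).
Qed.

Lemma large_subalgebra_annihilated A :
  is_subalgebra A -> 1%:M \notin A -> (r * m.+1 <= \dim A)%N -> annihilated A.
Proof.
move=> sA n1A dA.
pose e0 : 'rV[K]_r := delta_mx 0 0.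
have e0n0 : e0 != 0 by apply/matrix0Pn; exists 0, 0; rewrite mxE !eqxx oner_eq0.
pose f : 'Hom('cV[K]_r, 'M[K]_r) := linfun (mulmxr e0).
have f_inj : (fullv :&: lker f = 0)%VS.
  apply/eqP; rewrite -subv0 capfv; apply/subvP=> c.
  rewrite memv_ker lfunE /= memv0 => /eqP/(congr1 (mulmxr (delta_mx 0 (0 : 'I_1)))) /=.
  rewrite -mulmxA mul_delta_mx mul0mx.
  rewrite (_ : delta_mx 0 0 = 1%:M) ?mulmx1 => [->|] //.
  by apply/matrixP=> x y; rewrite !ord1 !mxE.
have [c c0 cA] : exists2 c : 'cV_r, c != 0 & c *m e0 \in (<[1%:M]> + A)%VS.
  (* \dim A1 + r > r * r. *)
  have : ((<[1%:M]> + A) :&: limg f)%VS != 0%VS.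
    rewrite -dimv_eq0; have := dimv_sum_cap (<[1%:M]> + A) (limg f).
    have := dimvS (subvf (<[1%:M]> + A + limg f)%VS).
    rewrite dim_adjoin1 // (limg_dim_eq f_inj) !dimvf !dim_matrix.
    rewrite -[(r * r)%R]/(r * r)%N -[(r * 1%N)%R]/(r * 1)%N.
    move: dA; set d := \dim A; set k := \dim (_ :&: _); set l := \dim _.
    by move: d k l => d k l; nia.
  rewrite -vpick0; have /memv_capP[] := memv_pick ((<[1%:M]> + A) :&: limg f).
  move=> pA /memv_imgP[c _ ec]; rewrite ec lfunE /= => p0.
  exists c; last by have <- : f c = c *m e0 by [rewrite lfunE]; rewrite -ec.
  by apply: contraNneq p0 => ->; rewrite mul0mx.
have [//|uP] := cyclic_or_annihilated sA n1A dA e0n0.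
have cT0 : c^T != 0 by rewrite trmx_eq0.
have [] := cyclic_or_annihilated (trspace_subalgebra sA) (one_notin_trspace n1A) _ cT0.
- by rewrite dim_trspace.
- exact: annihilated_tr.
move=> cP; case/negP: (n1A).
have dA1 i j : unit_at 1%:M i j \in (<[1%:M]> + A)%VS.
  have [X XA eX] := uP (delta_mx 0 j); have [Y] := cP (delta_mx 0 i).
  rewrite mem_adjoin1_tr => YA /(congr1 trmx); rewrite trmx_delta trmx_mul trmxK => eY.
  rewrite /unit_at invmx1 mul1mx mulmx1 -(mul_delta_mx (0 : 'I_1)) eX eY.
  by rewrite -mulmxA (mulmxA c); do 2?apply: (adjoin1_mul sA).
have u1 := unitmx1 K r.
(* The units (0, ord_max) and (ord_max, 0) multiply to the unit (0, 0). *)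
have E01 : unit_at 1%:M 0 ord_max \in A.
  by apply: (adjoin1_sqr0 sA n1A) => //; rewrite unit_atM.
have E00 : unit_at 1%:M 0 0 \in A.
  by have := adjoin1_mulr sA (dA1 ord_max 0) E01; rewrite unit_atM // eqxx.
rewrite -(sum_unit_at u1) memv_suml // => i _.
exact: (unit_at_diag u1 sA E00).
Qed.
End Core.

(** * Corners and changes of basis *)

Lemma row_transitive (K : fieldType) n (u v : 'rV[K]_n) :
  u != 0 -> v != 0 -> exists2 G, G \in unitmx & u *m G = v.
Proof.
case: n u v => [|n] u v u0 v0; first by rewrite [u]thinmx0 eqxx in u0.
have [T uT eT] := row_delta_unit 0 u0; have [T' uT' eT'] := row_delta_unit 0 v0.
exists (invmx T *m T'); first by rewrite unitmx_mul unitmx_inv uT.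
by rewrite mulmxA -eT mulmxK.
Qed.

(** The corner algebra of the idempotent 1 - b w of order n + 1 is identified
with the matrices of order n by X |-> Q X P, with inverse Y |-> P Y Q. *)
Lemma corner_split (K : fieldType) n (b : 'cV[K]_n.+1) (w : 'rV_n.+1) :
  w *m b = 1%:M ->
  exists (P : 'M_(n.+1, n)) (Q : 'M_(n, n.+1)),
    [/\ Q *m P = 1%:M, P *m Q = 1%:M - b *m w, Q *m b = 0 & w *m P = 0].
Proof.
move=> wb; pose F := 1%:M - b *m w.
have Fb : F *m b = 0 by rewrite mulmxBl mul1mx -mulmxA wb mulmx1 subrr.
have wF : w *m F = 0 by rewrite mulmxBr mulmx1 mulmxA wb mul1mx subrr.
have FF : F *m F = F by rewrite mulmxBl mul1mx -mulmxA wF mulmx0 subr0.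
have b0 : b != 0.
  by apply: contra_eq_neq wb => ->; rewrite mulmx0 eq_sym oner_eq0.
have rF : \rank F = n.
  apply/eqP; rewrite eqn_leq -ltnS; apply/andP; split.
    have := mulmx0_rank_max Fb; apply: leq_trans.
    by rewrite -addn1 leq_add2l lt0n mxrank_eq0.
  have : (\rank (F + b *m w)%R <= \rank F + 1)%N.
    by apply: (leq_trans (mxrank_add _ _)); rewrite leq_add2l mulmx_max_rank.
  by rewrite subrK mxrank1 addn1 ltnS.
have base k : \rank F = k -> exists (P : 'M_(n.+1, k)) (Q : 'M_(k, n.+1)),
    [/\ row_full P, row_free Q & P *m Q = F].
  move=> <-; exists (col_base F), (row_base F).
  by rewrite col_base_full row_base_free mulmx_base.
have [P [Q [fP fQ PQ]]] := base n rF.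
have QP : Q *m P = 1%:M.
  apply: (row_free_inj fQ); apply: (row_full_inj fP).
  by rewrite mul1mx -!mulmxA mulmxA mulmxA PQ -mulmxA PQ FF.
exists P, Q; split=> //; first by rewrite -[Q]mul1mx -QP -!mulmxA (mulmxA P) PQ Fb mulmx0.
by rewrite -[P]mulmx1 -QP (mulmxA P) PQ mulmxA wF mul0mx.
Qed.

(** Split off b and w, and carry h0 to h inside the complementary corner. *)
Lemma frame_transitive (K : fieldType) n (h w h0 w0 : 'rV[K]_n) (b b0 : 'cV_n) :
  h != 0 -> h *m b = 0 -> w *m b = 1%:M ->
  h0 != 0 -> h0 *m b0 = 0 -> w0 *m b0 = 1%:M ->
  exists2 S, S \in unitmx & [/\ h0 *m S = h, w0 *m S = w & S *m b = b0].
Proof.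
case: n h w h0 w0 b b0 => [|n] h w h0 w0 b b0 hn0 hb wb h0n0 h0b0 w0b0.
  by rewrite [h]thinmx0 eqxx in hn0.
have [P [Q [QP PQ Qb wP]]] := corner_split wb.
have [P0 [Q0 [QP0 PQ0 Qb0 wP0]]] := corner_split w0b0.
have hPQ : h *m P *m Q = h by rewrite -mulmxA PQ mulmxBr mulmx1 mulmxA hb mul0mx subr0.
have hPQ0 : h0 *m P0 *m Q0 = h0.
  by rewrite -mulmxA PQ0 mulmxBr mulmx1 mulmxA h0b0 mul0mx subr0.
have [||G uG eG] := @row_transitive K n (h0 *m P0) (h *m P).
- by apply: contraNneq h0n0 => e; rewrite -hPQ0 e mul0mx.
- by apply: contraNneq hn0 => e; rewrite -hPQ e mul0mx.
exists (P0 *m G *m Q + b0 *m w).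
  suff /mulmx1_unit[] : (P0 *m G *m Q + b0 *m w) *m
      (P *m invmx G *m Q0 + b *m w0) = 1%:M by [].
  rewrite mulmxDl !mulmxDr.
  rewrite -[b0 *m w *m (P *m _ *m _)]mulmxA -[P *m _ *m _]mulmxA.
  rewrite (mulmxA w) wP mul0mx mulmx0 add0r.
  rewrite -[_ *m (b *m w0)]mulmxA (mulmxA Q) Qb mul0mx mulmx0 addr0.
  rewrite -[_ *m (P *m _)]mulmxA (mulmxA Q) QP mul1mx mulmxA mulmxK // PQ0.
  by rewrite -[b0 *m w *m _]mulmxA (mulmxA w) wb mul1mx subrK.
split.
- by rewrite mulmxDr !mulmxA eG hPQ h0b0 mul0mx addr0.
- by rewrite mulmxDr !mulmxA wP0 !mul0mx w0b0 mul1mx add0r.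
by rewrite mulmxDl -!mulmxA Qb wb !mulmx0 mulmx1 add0r.
Qed.

(** * Similarity *)

Lemma similar_tr (K : fieldType) n (N B : {vspace 'M[K]_n}) :
  similar_subalgebras N (trspace B) -> similar_subalgebras (trspace N) B.
Proof.
case=> S uS NB; have uT : S^T \in unitmx by rewrite unitmx_tr.
exists (invmx S^T); first by rewrite unitmx_inv.
move=> X; rewrite mem_trspace invmxK; split.
  case/NB=> Y; rewrite mem_trspace => YB /(congr1 trmx); rewrite trmxK => ->.
  by exists Y^T; rewrite // !trmx_mul trmx_inv mulmxA.
case=> Y YB ->; apply/NB; exists Y^T; first by rewrite mem_trspace trmxK.
by rewrite !trmx_mul trmx_inv trmxK mulmxA.
Qed.

Lemma similar_sandwich (K : fieldType) n (N B : {vspace 'M[K]_n}) S :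
  (forall X, X \in N <-> exists2 Y, Y \in B & X = invmx S *m Y *m S) <->
  N = (sandwich (invmx S) S @: B)%VS.
Proof.
split=> [NB|-> X].
  apply/vspaceP=> X; apply/idP/memv_imgP => [/NB[Y YB ->]|[Y YB ->]].
    by exists Y; rewrite ?sandwichE.
  by apply/NB; exists Y; rewrite ?sandwichE.
split=> [/memv_imgP[Y YB ->]|[Y YB ->]]; first by exists Y; rewrite ?sandwichE.
by apply/memv_imgP; exists Y; rewrite ?sandwichE.
Qed.

Lemma dim_conj (K : fieldType) n (B : {vspace 'M[K]_n}) S : S \in unitmx ->
  \dim (sandwich (invmx S) S @: B) = \dim B.
Proof.
move=> uS; apply/limg_dim_eq/eqP; rewrite -subv0; apply/subvP=> X /memv_capP[_].
rewrite memv_ker sandwichE memv0 => /eqP e.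
by rewrite -(mulmxK uS X) -(mulKVmx uS (X *m S)) (mulmxA (invmx S)) e mulmx0 mul0mx.
Qed.

(** * The algebra W *)

Section Model.
Variables (K : fieldType) (m : nat).
Local Notation n := m.+3.
Local Notation W := (Wspace K n).
Local Notation k := (inord m.+1 : 'I_n).

Lemma mem_Wspace X : X \in W <->
  [/\ delta_mx (0 : 'I_1) k *m X = 0, delta_mx (0 : 'I_1) ord_max *m X = 0
    & X *m delta_mx ord_max (0 : 'I_1) = 0].
Proof.
rewrite -!rowE -colE; split=> [/vanishing_spaceP XW|[rk rm cm]].
  split; apply/matrixP=> i j; rewrite !mxE XW //=.
  - by rewrite inordK ?eqxx ?orbT.
  - by rewrite eqxx.
  - by rewrite eqxx !orbT.
apply/vanishing_spaceP=> i j /or3P[] /eqP e.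
- have <- : ord_max = i by apply: val_inj.
  by move/rowP/(_ j): rm; rewrite !mxE.
- have <- : k = i by apply: val_inj; rewrite /= inordK.
  by move/rowP/(_ j): rk; rewrite !mxE.
have <- : ord_max = j by apply: val_inj.
by move/colP/(_ i): cm; rewrite !mxE.
Qed.

Lemma pid_mul_rows a p q (X : 'M[K]_(p, q)) :
  (forall (i : 'I_p) j, (a <= i)%N -> X i j = 0) -> pid_mx a *m X = X.
Proof.
move=> X0; apply/matrixP=> i j; rewrite mxE (bigD1 i) //= big1 => [|l li].
  by rewrite mxE eqxx addr0 /=; case: ltnP => [|/X0->]; rewrite ?mul1r ?mulr0.
by rewrite mxE eq_sym val_eqE (negPf li) mul0r.
Qed.

Lemma pid_mul_cols a p q (X : 'M[K]_(p, q)) :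
  (forall i (j : 'I_q), (a <= j)%N -> X i j = 0) -> X *m pid_mx a = X.
Proof.
move=> X0; apply: trmx_inj; rewrite trmx_mul tr_pid_mx pid_mul_rows // => i j ai.
by rewrite mxE X0.
Qed.

Lemma dim_Wspace : \dim W = (m.+2 * m.+1)%N.
Proof.
pose f := sandwich (pid_mx m.+1 : 'M[K]_(n, m.+1)) (pid_mx m.+2 : 'M_(m.+2, n)).
pose g := sandwich (pid_mx m.+1 : 'M[K]_(m.+1, n)) (pid_mx m.+2 : 'M_(n, m.+2)).
have gf X : g (f X) = X.
  rewrite !sandwichE !mulmxA -(mulmxA _ (pid_mx _) (pid_mx _)) !mul_pid_mx.
  rewrite !minnn !(minn_idPr _) ?pid_mx_1 ?mulmx1 ?mul1mx //; lia.
have -> : W = limg f.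
  apply/vspaceP=> X; apply/idP/memv_imgP => [/vanishing_spaceP X0 | [Y _ ->]].
    exists (g X); rewrite ?memvf // !sandwichE !mulmxA.
    rewrite -(mulmxA _ (pid_mx _) (pid_mx _)) !mul_pid_mx !minnn.
    rewrite pid_mul_rows ?pid_mul_cols // => i j lei; apply: X0.
      by apply/or3P/Or33/eqP; have := ltn_ord j; rewrite /=; lia.
    by have := ltn_ord i; rewrite /=; lia.
  apply/vanishing_spaceP => i j P; rewrite sandwichE.
  case/or3P: P => /eqP e.
  - rewrite -mulmxA mxE big1 // => l _; rewrite mxE e ltnNge /=.
    by rewrite leqW ?andbF ?mul0r.
  - by rewrite -mulmxA mxE big1 // => l _; rewrite mxE e ltnn andbF mul0r.
  rewrite mxE big1 // => l _; rewrite [pid_mx _ _ _]mxE (_ : _ == _ = false) ?mulr0 //.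
  by rewrite e /=; have := ltn_ord l; lia.
rewrite limg_dim_eq ?dimvf ?dim_matrix 1?mulnC //.
apply/eqP; rewrite -subv0; apply/subvP=> X /memv_capP[_].
by rewrite memv_ker memv0 => /eqP fX; rewrite -(gf X) fX linear0.
Qed.

Lemma delta_row_neq0 i : delta_mx (0 : 'I_1) i != 0 :> 'rV[K]_n.
Proof. by apply/matrix0Pn; exists 0, i; rewrite mxE !eqxx oner_eq0. Qed.

Lemma kmax : (k == ord_max) = false.
Proof. by rewrite -val_eqE /= inordK //; lia. Qed.

(** The three annihilators put N inside a conjugate of W; equality is a matter of
dimension. *)
Lemma similar_Wspace (N : {vspace 'M[K]_n}) (h w : 'rV_n) (b : 'cV_n) :
  \dim N = (m.+2 * m.+1)%N ->
  h != 0 -> h *m b = 0 -> w *m b = 1%:M ->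
  {in N, forall X, [/\ h *m X = 0, w *m X = 0 & X *m b = 0]} ->
  similar_subalgebras N W.
Proof.
move=> dN h0 hb wb annN.
have [|||S uS [hS wS Sb]] := frame_transitive (h0 := delta_mx 0 k)
    (w0 := delta_mx 0 ord_max) (b0 := delta_mx ord_max 0) h0 hb wb.
- exact: delta_row_neq0.
- by rewrite mul_delta_mx_cond kmax.
- by rewrite mul_delta_mx; apply/matrixP=> x y; rewrite !ord1 !mxE.
exists S => //; apply/similar_sandwich/eqP.
rewrite eqEdim dim_conj // dim_Wspace dN leqnn andbT.
apply/subvP=> X /annN[hX wX Xb]; apply/memv_imgP; exists (S *m X *m invmx S).
  apply/mem_Wspace; split.
  - by rewrite !mulmxA hS hX mul0mx.
  - by rewrite !mulmxA wS wX mul0mx.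
  by rewrite -Sb !mulmxA mulmxKV // -mulmxA Xb mulmx0.
by rewrite sandwichE !mulmxA mulVmx // mul1mx mulmxKV.
Qed.

(** W is nonunital because it contains the matrix unit Z in row 0 and column k,
while Z E = 0 for all E in W, their row k being zero. *)
Lemma Wspace_intersection (N : {vspace 'M[K]_n}) :
  is_subalgebra N -> similar_subalgebras N W ->
  nonunital_intersection N /\ \dim N = (m.+2 * m.+1)%N.
Proof.
move=> sN [S uS NW]; split; last first.
  by move/similar_sandwich: NW => ->; rewrite dim_conj // dim_Wspace.
apply/nonunital_intersectionP; split.
  split=> // -[_ /NW[E /mem_Wspace[kE _ _] ->] uE].
  pose Z : 'M[K]_n := delta_mx 0 k.
  have ZW : Z \in W.
    apply/mem_Wspace; rewrite /Z !mul_delta_mx_cond kmax.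
    have [-> ->] : (k == 0) = false /\ (ord_max == 0 :> 'I_n) = false.
      by rewrite -!val_eqE /= inordK.
    by [].
  have ZN : invmx S *m Z *m S \in N by apply/NW; exists Z.
  have [_] := uE _ ZN; rewrite -!mulmxA mulKVmx // (mulmxA Z).
  rewrite /Z -(mul_delta_mx (0 : 'I_1)) -(mulmxA _ _ E) kE mulmx0 mul0mx mulmx0.
  move/esym/(congr1 (fun M => S *m M *m invmx S)).
  rewrite mulKVmx // mulmxK // mulmx0 mul0mx => /matrixP/(_ 0 k).
  by rewrite mul_delta_mx !mxE !eqxx => /eqP; rewrite oner_eq0.
exists (invmx S *m delta_mx ord_max 0), (delta_mx 0 ord_max *m S); split.
- rewrite -mulmxA mulKVmx // mul_delta_mx.
  by apply/matrixP=> x y; rewrite !ord1 !mxE.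
- move=> _ /NW[Y /mem_Wspace[_ _ cY] ->].
  by rewrite -!mulmxA mulKVmx // cY mulmx0.
move=> _ /NW[Y /mem_Wspace[_ rY _] ->].
by rewrite -!mulmxA mulKVmx // (mulmxA _ Y) rY mul0mx.
Qed.

(** The copy of N in the corner of 1 - b w is large enough to kill a vector there;
seen in order n, that vector is independent of w or b. *)
Lemma third_annihilator (N : {vspace 'M[K]_n}) (b : 'cV_n) (w : 'rV_n) :
  nonunital_subalgebra N -> \dim N = (m.+2 * m.+1)%N ->
  w *m b = 1%:M -> {in N, forall X, X *m b = 0} -> {in N, forall X, w *m X = 0} ->
  (exists h : 'rV_n, [/\ h != 0, h *m b = 0 & {in N, forall X, h *m X = 0}]) \/
  (exists c : 'cV_n, [/\ c != 0, w *m c = 0 & {in N, forall X, X *m c = 0}]).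
Proof.
move=> [sN nuN] dN wb Nb wN; have [P [Q [QP PQ Qb wP]]] := corner_split wb.
pose A := (sandwich Q P @: N)%VS.
have PQN : {in N, forall X, P *m Q *m X = X /\ X *m (P *m Q) = X}.
  move=> X XN; rewrite PQ mulmxBl mulmxBr mul1mx mulmx1 -mulmxA wN // mulmxA Nb //.
  by rewrite mulmx0 mul0mx subr0.
have sA : is_subalgebra A.
  move=> _ _ /memv_imgP[X XN ->] /memv_imgP[Y YN ->].
  apply/memv_imgP; exists (X *m Y); first exact: sN.
  by rewrite !sandwichE -!mulmxA (mulmxA P) (mulmxA (P *m Q)) (PQN Y YN).1.
have n1A : 1%:M \notin A.
  apply/negP => /memv_imgP[E EN]; rewrite sandwichE => eE; case: nuN; exists E => //.
  suff -> : E = P *m Q by [].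
  by rewrite -(PQN E EN).1 -{1}(PQN E EN).2 -[Q in RHS]mul1mx eE !mulmxA.
have dA : \dim A = (m.+2 * m.+1)%N.
  rewrite -dN; apply/limg_dim_eq/eqP; rewrite -subv0; apply/subvP=> X /memv_capP[XN].
  rewrite memv_ker sandwichE memv0 -(PQN X XN).1 => /eqP.
  move/(congr1 (fun M => P *m M *m Q)); rewrite mulmx0 mul0mx => <-.
  by rewrite -!mulmxA (mulmxA Q P) QP mul1mx (PQN X XN).2.
have QXP X : X \in N -> Q *m X *m P \in A.
  by move=> XN; apply/memv_imgP; exists X; rewrite ?sandwichE.
have [] := large_subalgebra_annihilated sA n1A; first by rewrite dA.
- case=> g g0 gA; left; exists (g *m Q); split.
  + by apply: contraNneq g0 => e; rewrite -[g]mulmx1 -QP mulmxA e mul0mx.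
  + by rewrite -mulmxA Qb mulmx0.
  by move=> X XN; rewrite -(PQN X XN).2 !mulmxA -2!(mulmxA g) gA ?mul0mx ?QXP.
case=> c c0 Ac; right; exists (P *m c); split.
- by apply: contraNneq c0 => e; rewrite -[c]mul1mx -QP -mulmxA e mulmx0.
- by rewrite mulmxA wP mul0mx.
move=> X XN; rewrite -(PQN X XN).1 -!mulmxA (mulmxA X) (mulmxA Q) (mulmxA Q).
by rewrite Ac ?mulmx0 ?QXP.
Qed.
End Model.

(** * Classification *)

Theorem theorem3p2 (K : fieldType) (charK0 : [pchar K] =i pred0)
    (n : nat) (n_ge3 : (3 <= n)%N)
    (N : {vspace 'M[K]_n}) (subN : is_subalgebra N) :
  (nonunital_intersection N /\ \dim N = ((n - 1) * (n - 2))%N)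
  <-> (similar_subalgebras N (Wspace K n)
       \/ similar_subalgebras N (Wspace_tr K n)).
Proof.
case: n n_ge3 N subN => [|[|[|m]]] // _ N sN; rewrite subn1 subn2 /=.
split=> [[/nonunital_intersectionP[nuN [b [w [wb Nb wN]]]] dN]|].
  have [[h [h0 hb hN]]|[c [c0 wc Nc]]] := third_annihilator nuN dN wb Nb wN.
    left; apply: (similar_Wspace dN h0 hb wb) => X XN.
    by rewrite hN ?wN ?Nb.
  right; rewrite -[N]trspaceK; apply: similar_tr; rewrite trspaceK.
  apply: (similar_Wspace (h := c^T) (w := b^T) (b := w^T)).
  - by rewrite dim_trspace.
  - by rewrite trmx_eq0.
  - by rewrite -trmx_mul wc trmx0.
  - by rewrite -trmx_mul wb trmx1.
  move=> X; rewrite mem_trspace => XN; rewrite -[X]trmxK.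
  by rewrite -!trmx_mul (Nc _ XN) (Nb _ XN) (wN _ XN) !trmx0.
case=> [|/similar_tr simN]; first exact: Wspace_intersection.
have [nuN dN] := Wspace_intersection (trspace_subalgebra sN) simN.
by rewrite -[N]trspaceK dim_trspace; split; first exact: trspace_nonunital_intersection.
Qed.
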